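(* Every URC lattice is distributive.
   Context: For an interval $[a,b]$ of a lattice $L$ and $c,d\in[a,b]$, the set $\{c,d\}$ is a complementary set of $[a,b]$ if $c\vee d=b$, $c\wedge d=a$ and $\{c,d\}\ne\{a,b\}$. A lattice $L$ is a URC lattice (uniquely relatively complemented) if for every interval $[a,b]$ of $L$ either $[a,b]$ is a chain or there exists a unique complementary set $\{c,d\}$ of $[a,b]$. *)

(* Defs.v *)
From mathcomp Require Import all_boot all_order interval.
From mathcomp Require Import classical_sets.

Set Implicit Arguments.
Unset Strict Implicit.
Unset Printing Implicit Defensive.

Local Open Scope order_scope.
Local Open Scope classical_set_scope.

(* S is an unordered pair {c, e}, so that (c, e) and (e, c) count once. *)
Definition complementary_set {disp : Order.disp_t} {L : latticeType disp}
    (a b : L) (S : set L) : Prop :=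
  exists c e : L,
    [/\ S = [set c; e], c \in `[a, b]%O /\ e \in `[a, b]%O,
        (c `|` e)%O = b, (c `&` e)%O = a & S <> [set a; b]].

Definition chain_interval {disp : Order.disp_t} {L : latticeType disp}
    (a b : L) : Prop :=
  {in `[a, b]%O &, forall x y : L, x >=< y}.

Definition URC {disp : Order.disp_t} (L : latticeType disp) : Prop :=
  forall a b : L, a <= b ->
    chain_interval a b \/ exists! S : set L, complementary_set a b S.

Definition distributive_lattice {disp : Order.disp_t}
    (L : latticeType disp) : Prop :=
  right_distributive (@Order.meet disp L) (@Order.join disp L).

(* Main.v *)
(* Two distinct complements of an element in an interval give two distinct
   complementary sets, so relative complements are unique: [x /\ z = y /\ z] and
   [x \/ z = y \/ z] force [x = y].  Cancellation in the pentagon gives modularity.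
   In a modular lattice with lower and upper medians [o <= i] of [x, y, z], the
   elements [(t /\ i) \/ o] for [t = x, y, z] pairwise meet in [o] and join to [i];
   by cancellation they coincide, hence [o = i], which is distributivity. *)

Require Import Defs.
From mathcomp Require Import all_boot all_order.
From mathcomp Require Import interval boolp classical_sets.

Set Implicit Arguments.
Unset Strict Implicit.
Unset Printing Implicit Defensive.

Import Order.Theory.
Local Open Scope order_scope.

Definition cancellative {disp : Order.disp_t} (L : latticeType disp) : Prop :=
  forall x y z : L, x `&` z = y `&` z -> x `|` z = y `|` z -> x = y.

Definition modular {disp : Order.disp_t} (L : latticeType disp) : Prop :=
  forall x y z : L, x <= z -> (x `|` y) `&` z = x `|` (y `&` z).

Definition lower_median {disp : Order.disp_t} {L : latticeType disp}
    (x y z : L) : L := (x `&` y) `|` (x `&` z) `|` (y `&` z).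

Definition upper_median {disp : Order.disp_t} {L : latticeType disp}
    (x y z : L) : L := (x `|` y) `&` (x `|` z) `&` (y `|` z).

(** The candidate atoms of a diamond [M_3] whose bottom and top are the two medians. *)
Definition median_shift {disp : Order.disp_t} {L : latticeType disp}
    (x y z : L) : L := (x `&` upper_median x y z) `|` lower_median x y z.

Lemma set2_injr (T : Type) (c d e : T) :
  [set c; d]%classic = [set c; e]%classic -> d = e.
Proof.
move=> E.
have : [set c; e]%classic d by rewrite -E; right.
have : [set c; d]%classic e by rewrite E; right.
by move=> [->|->] // [->|->].
Qed.

Section Lattice.
Variables (disp : Order.disp_t) (L : latticeType disp).
Implicit Types x y z : L.

Lemma complement_of_endpoints (a b c d : L) :
  c `&` d = a -> c `|` d = b -> [set c; d]%classic = [set a; b]%classic ->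
  c = a /\ d = b \/ c = b /\ d = a.
Proof.
move=> <- <- E.
have [] : [set (c `&` d)%O; (c `|` d)%O]%classic c by rewrite -E; left.
- by move=> /= ec; left; split=> //; apply/esym/join_r; rewrite ec leIr.
- by move=> /= ec; right; split=> //; apply/esym/meet_r; rewrite ec leUr.
Qed.

Lemma complementary_set_unique (a b : L) (S T : set L) :
  URC L -> a <= b -> complementary_set a b S -> complementary_set a b T -> S = T.
Proof.
move=> hL ab hS hT; have [ch|[U [_ uU]]] := hL _ _ ab; last first.
  by rewrite -(uU _ hS) -(uU _ hT).
(* In a chain [c] and [d] are comparable, so they are the endpoints themselves, a pair that
   [complementary_set] excludes. *)
case: hS => c [d [-> [cI dI] cdb cda []]].
have /orP[cd|dc] : (c <= d) || (d <= c) by exact: ch.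
- by rewrite -cdb -cda (join_r cd) (meet_l cd).
- by rewrite -cdb -cda (join_l dc) (meet_r dc) setUC.
Qed.

Lemma URC_cancellative : URC L -> cancellative L.
Proof.
move=> hL x y z; rewrite ![_ `&` z]meetC ![_ `|` z]joinC => eI eU.
have mem t u :
    t \in `[(t `&` u)%O, (t `|` u)%O] /\ u \in `[(t `&` u)%O, (t `|` u)%O].
  by rewrite !in_itv /= leIl leUl leIr leUr.
(* A pair equal to the endpoints is not a complementary set. In that case its two elements are
   comparable, and [eI], [eU] give [x = y] directly. *)
have [Ex|Nx] :=
  pselect ([set z; x]%classic = [set (z `&` x)%O; (z `|` x)%O]%classic).
  have [[zE xE]|[zE xE]] := complement_of_endpoints erefl erefl Ex.
  - by rewrite xE eU; apply/join_r; rewrite zE eI leIr.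
  - by rewrite xE eI; apply/meet_r; rewrite zE eU leUr.
have [Ey|Ny] :=
  pselect ([set z; y]%classic = [set (z `&` y)%O; (z `|` y)%O]%classic).
  have [[zE yE]|[zE yE]] := complement_of_endpoints erefl erefl Ey.
  - by rewrite yE -eU; apply/esym/join_r; rewrite zE -eI leIr.
  - by rewrite yE -eI; apply/esym/meet_r; rewrite zE -eU leUr.
(* Now [{z, x}] and [{z, y}] are both complementary sets of the same interval. *)
apply: (@set2_injr _ z).
apply: (@complementary_set_unique (z `&` x) (z `|` x)) => //.
- by rewrite (le_trans (leIl _ _)) ?leUl.
- by exists z, x; split=> //; apply: mem.
- by rewrite eI eU; exists z, y; split=> //; apply: mem.
Qed.

(** Both sides of the modular law meet [y] in [y /\ z] and join with [y] to [x \/ y]; were they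
    distinct, they would span a pentagon with [y]. *)
Lemma cancellative_modular : cancellative L -> modular L.
Proof.
move=> hc x y z xz; apply: (hc _ _ y).
- apply/le_anti/andP; split.
  + by rewrite lexI leIr andbT (le_trans _ (leUr _ _)) // [y `&` z]meetC
      leI2 ?leIr.
  + by rewrite leI2 // leUx !lexI leUl xz leIr (le_trans (leIl _ _)) ?leUr.
- rewrite -joinA [(y `&` z) `|` y]join_r ?leIl //.
  apply/le_anti/andP; split.
  + by rewrite leUx leIl leUr.
  + by rewrite leUx leUr andbT (le_trans _ (leUl _ _)) // lexI leUl.
Qed.

Lemma lower_medianCA x y z : lower_median x y z = lower_median y x z.
Proof. by rewrite /lower_median [y `&` x]meetC -!joinA [X in _ `|` X]joinC. Qed.

Lemma lower_medianAC x y z : lower_median x y z = lower_median x z y.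
Proof.
by rewrite /lower_median [z `&` y]meetC [(x `&` z) `|` (x `&` y)]joinC.
Qed.

Lemma upper_medianCA x y z : upper_median x y z = upper_median y x z.
Proof. by rewrite /upper_median [y `|` x]joinC -!meetA [X in _ `&` X]meetC. Qed.

Lemma upper_medianAC x y z : upper_median x y z = upper_median x z y.
Proof.
by rewrite /upper_median [z `|` y]joinC [(x `|` z) `&` (x `|` y)]meetC.
Qed.

Lemma median_shiftAC x y z : median_shift x y z = median_shift x z y.
Proof. by rewrite /median_shift lower_medianAC upper_medianAC. Qed.

Lemma lower_le_upper_median x y z : lower_median x y z <= upper_median x y z.
Proof.
rewrite /lower_median /upper_median !leUx !lexI.
by rewrite !(le_trans (leIl _ _) (leUl _ _)) !(le_trans (leIl _ _) (leUr _ _))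
  !(le_trans (leIr _ _) (leUl _ _)) !(le_trans (leIr _ _) (leUr _ _)).
Qed.

Lemma meet_upper_median x y z : x `&` upper_median x y z = x `&` (y `|` z).
Proof. by rewrite /upper_median !meetA joinKI joinKI. Qed.

Lemma join_lower_median x y z : x `|` lower_median x y z = x `|` (y `&` z).
Proof. by rewrite /lower_median !joinA meetKU meetKU. Qed.

(** Meeting first or joining first makes no difference, so the shift is a self-dual expression. *)
Lemma modular_median_shift x y z : modular L ->
  median_shift x y z = (x `|` lower_median x y z) `&` upper_median x y z.
Proof.
move=> hm; rewrite /median_shift [x `|` _]joinC hm ?lower_le_upper_median //.
exact: joinC.
Qed.

(** Modularity pulls out the two terms below [x]; what remains, [x /\ y /\ z], is absorbed. *)
Lemma meet_lower_median x y z : modular L ->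
  x `&` lower_median x y z = (x `&` y) `|` (x `&` z).
Proof.
move=> hm; rewrite meetC /lower_median hm ?leUx ?leIl //.
by apply/join_l; rewrite (le_trans _ (leUl _ _)) // meetC leI2 ?leIl.
Qed.

Lemma median_shift_meet x y z : modular L ->
  median_shift x y z `&` median_shift y x z = lower_median x y z.
Proof.
move=> hm; rewrite {1}/median_shift [X in X `&` _]joinC hm; last first.
  by rewrite /median_shift -lower_medianCA leUr.
(* Modularity has extracted the lower median. The remaining meet is bounded using the other form of
   the shift of [y], and a second use of modularity splits this bound into [x /\ y] and [x /\ z]. *)
apply/join_l/(@le_trans _ _ (x `&` (y `|` (x `&` z)))).
  by rewrite leI2 ?leIl // modular_median_shift // join_lower_median leIl.
rewrite meetC [y `|` _]joinC hm ?leIl // [y `&` x]meetC joinC.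
exact: leUl.
Qed.

End Lattice.

Lemma modular_dual (disp : Order.disp_t) (L : latticeType disp) :
  modular L -> modular L^d.
Proof.
move=> hm x y z xz.
rewrite [LHS]meetC [RHS]joinC [x `|^d` y]joinC [y `&^d` z]meetC.
exact/esym/(hm z y x).
Qed.

Section Modular.
Variables (disp : Order.disp_t) (L : latticeType disp).
Implicit Types x y z : L.

(** Passing to [L^d] exchanges the medians and the two forms of the shift, so this is the dual of
    [median_shift_meet]. *)
Lemma median_shift_join x y z : modular L ->
  median_shift x y z `|` median_shift y x z = upper_median x y z.
Proof.
move=> hm; rewrite !modular_median_shift //.
exact: (@median_shift_meet _ L^d x y z (modular_dual hm)).
Qed.

Lemma cancellative_median x y z :
  cancellative L -> lower_median x y z = upper_median x y z.
Proof.
move=> hc; have hm := cancellative_modular hc.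
have xy : median_shift x y z = median_shift y x z.
  (* The third shift is a common relative complement of the other two between the medians. *)
  apply: (hc _ _ (median_shift z x y)).
  - rewrite median_shiftAC median_shift_meet //.
    rewrite [median_shift y x z]median_shiftAC.
    rewrite [median_shift z x y]median_shiftAC median_shift_meet //.
    by rewrite lower_medianAC lower_medianCA lower_medianAC.
  - rewrite median_shiftAC median_shift_join //.
    rewrite [median_shift y x z]median_shiftAC.
    rewrite [median_shift z x y]median_shiftAC median_shift_join //.
    by rewrite upper_medianAC upper_medianCA upper_medianAC.
by rewrite -median_shift_meet // -median_shift_join // -xy meetxx joinxx.
Qed.

(** Meeting [x] with the upper median gives one side of the law, with the lower median the other. *)
Lemma cancellative_distributive : cancellative L -> distributive_lattice L.
Proof.
move=> hc x y z; rewrite -meet_upper_median -cancellative_median //.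
by rewrite meet_lower_median //; apply: cancellative_modular.
Qed.

End Modular.

Theorem theorem1p4 (disp : Order.disp_t) (L : latticeType disp) (hL : URC L) :
  distributive_lattice L.
Proof. exact/cancellative_distributive/URC_cancellative. Qed.
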